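(* Let $b\ge 1$ and consider the Strings-and-Coins game on the complete bipartite graph $K(2,b)$ (equivalently $K(b,2)$). Under optimal play, Player 1 wins if $b$ is odd and Player 2 wins if $b$ is even.
   Context: Strings-and-Coins game: played on a finite graph in which every vertex initially has at least one incident edge. Two players, Player 1 moving first, alternately remove one edge. Whenever a removal leaves one or more vertices with no incident edges, the mover earns one point for each such vertex and must move again, provided edges remain. The game ends when no edges remain; a player wins if they have more points. Optimal play means each player maximizes (own final score) minus (opponent's final score). $K(a,b)$ denotes the complete bipartite graph with parts of sizes $a$ and $b$. *)

(* Defs.v *)
From mathcomp Require Import all_boot all_order all_algebra.

Set Implicit Arguments.
Unset Strict Implicit.
Unset Printing Implicit Defensive.

Import Order.TTheory GRing.Theory Num.Theory.

Inductive player := Player1 | Player2.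

Definition opponent (p : player) : player :=
  if p is Player1 then Player2 else Player1.

Section StringsAndCoins.

Variable T : finType.

(* The edges of a simple graph (a symmetric irreflexive relation), as unordered
   pairs of vertices. *)
Definition edges (adj : rel T) : {set {set T}} :=
  [set [set p.1; p.2] | p : T * T & adj p.1 p.2].

Record state := State {
  remaining : {set {set T}};
  mover : player;
  score1 : nat;
  score2 : nat
}.

Definition score (s : state) (p : player) : nat :=
  if p is Player1 then score1 s else score2 s.

(* [cover E] is the set of vertices incident with an edge of [E]: this counts
   the vertices that lose their last edge when [e] is removed. *)
Definition points (E : {set {set T}}) (e : {set T}) : nat :=
  #|cover E :\: cover (E :\ e)|.

Definition move (s : state) (e : {set T}) : state :=
  let k := points (remaining s) e in
  let p := if k == 0 then opponent (mover s) else mover s in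
  if mover s is Player1
  then State (remaining s :\ e) p (score1 s + k) (score2 s)
  else State (remaining s :\ e) p (score1 s) (score2 s + k).

Definition start (adj : rel T) : state := State (edges adj) Player1 0 0.

Definition margin (p : player) (s : state) : int :=
  ((score s p)%:Z - (score s (opponent p))%:Z)%R.

(* [optimal_after n s f]: state [f] can be reached from [s] by [n] moves of
   optimal play. At each turn the mover removes an edge for which, the
   remaining moves being optimal, the mover's margin in the last state is as
   large as possible. *)
Fixpoint optimal_after (n : nat) (s f : state) : Prop :=
  if n is m.+1 then
    exists e : {set T},
      [/\ e \in remaining s,
          optimal_after m (move s e) f
        & forall (e' : {set T}) (f' : state),
            e' \in remaining s -> optimal_after m (move s e') f' ->
            (margin (mover s) f' <= margin (mover s) f)%R]
  else f = s.

(* Each move removes exactly one edge, so a complete game lasts [#|edges adj|]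
   moves. *)
Definition optimal_final (adj : rel T) (f : state) : Prop :=
  optimal_after #|edges adj| (start adj) f.

Definition wins (p : player) (adj : rel T) : Prop :=
  forall f : state, optimal_final adj f -> score f (opponent p) < score f p.

Lemma optimal_after_margin n s f g p :
  optimal_after n s f -> optimal_after n s g -> margin p f = margin p g.
Proof.
have marginN q t : margin (opponent q) t = (- margin q t)%R.
  by rewrite /margin opprB; case: q.
case: n => [-> -> //|n] /= [e [eE ef fmax]] [e' [e'E eg gmax]].
have mE : margin (mover s) f = margin (mover s) g.
  by apply/le_anti; rewrite (gmax _ _ eE ef) (fmax _ _ e'E eg).
have [<- //|->] : mover s = p \/ p = opponent (mover s).
  by case: (mover s) (p) => [] []; auto.
by rewrite !marginN mE.
Qed.

Lemma remaining_move s e : remaining (move s e) = remaining s :\ e.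
Proof. by rewrite /move; case: (mover s). Qed.

Lemma optimal_after_exists n s :
  n <= #|remaining s| -> exists f, optimal_after n s f.
Proof.
elim: n s => [|n IHn] s; first by exists s.
move=> ltn; have /card_gt0P[e0 e0E] : 0 < #|remaining s| by apply: leq_trans ltn.
have /fin_all_exists[F FP] (e : {set T}) :
    exists f, e \in remaining s -> optimal_after n (move s e) f.
  case: (boolP (e \in remaining s)) => [eE|_]; last by exists s.
  have [|f fP] := IHn (move s e); last by exists f.
  by rewrite remaining_move -ltnS (leq_trans ltn) // (cardsD1 e) eE.
case: (@Order.TotalTheory.arg_maxP _ _ _ e0 (mem (remaining s))
         (fun e => margin (mover s) (F e)) e0E) => e eE emax.
exists (F e), e; split=> // [|e' f' e'E e'f']; first exact: FP.
by rewrite (optimal_after_margin _ e'f' (FP _ e'E)); apply: emax.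
Qed.

(* In particular [wins] is never vacuously true. *)
Lemma optimal_final_exists adj : exists f, optimal_final adj f.
Proof. exact: optimal_after_exists. Qed.

End StringsAndCoins.

Definition K (a b : nat) : rel ('I_a + 'I_b) :=
  fun x y => match x, y with
             | inl _, inr _ | inr _, inl _ => true
             | _, _ => false
             end.

Arguments K a b : clear implicits.

(* Main.v *)
(** Write f(n) for the optimal margin of the player to move on K(2,n), whose
    vertices are two hubs of degree n and n rim vertices of degree 2.  As long
    as some rim vertex keeps both of its edges, a rim vertex of degree one can be
    captured for exactly one point and no loss of the move.  By strong induction
    f(n) >= 1 for odd n and f(n) <= -2 for even n > 0.  If n is even, any first
    move offers a rim vertex; capturing it leaves K(2,n-1) to the same player,
    so f(n) <= -(1 + f(n-1)).  If n > 1 is odd, the opponent, offered a rim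
    vertex, either captures it and must then open K(2,n-1), or offers a second
    one, and the first player captures both and is to move on K(2,n-2). *)
Require Import Defs.
From mathcomp Require Import all_boot all_order all_algebra.
From mathcomp Require Import zify.

Set Implicit Arguments.
Unset Strict Implicit.
Unset Printing Implicit Defensive.

Import Order.TTheory GRing.Theory Num.Theory.

(** * Bounds on the gain still to come for the player to move *)

Section Bounds.

Variable T : finType.
Implicit Types (E : {set {set T}}) (s f : state T) (e : {set T}) (c : int).

(** The gain still to come depends only on the remaining edges, so the bound ranges over every mover
    and every score and is taken relative to the current margin. One-sided bounds avoid computing
    the value of the game. *)
Definition lower E c := forall s f,
  remaining s = E -> optimal_after #|E| s f ->
  (margin (mover s) s + c <= margin (mover s) f)%R.

Definition upper E c := forall s f,
  remaining s = E -> optimal_after #|E| s f ->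
  (margin (mover s) f <= margin (mover s) s + c)%R.

Lemma margin_opponent p s : margin (opponent p) s = (- margin p s)%R.
Proof. by case: p; rewrite /margin opprB. Qed.

Lemma margin_move s e :
  margin (mover s) (move s e)
  = (margin (mover s) s + (points (remaining s) e)%:Z)%R.
Proof. by rewrite /margin /move; case: (mover s) => /=; lia. Qed.

Lemma mover_move s e :
  mover (move s e)
  = if points (remaining s) e == 0 then opponent (mover s) else mover s.
Proof. by rewrite /move; case: (mover s). Qed.

Lemma lower_le E c d : lower E d -> (c <= d)%R -> lower E c.
Proof. by move=> low lecd s f sE sf; have := low s f sE sf; lia. Qed.

Lemma lower_set0 : lower set0 0.
Proof. by move=> s f _; rewrite cards0 => ->; rewrite addr0. Qed.

(** One good move suffices: some optimal play starts after [e], and the maximality clause makes the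
    play at hand no worse for the mover. *)
Lemma lower_move E e c : e \in E ->
  (forall s f, remaining s = E -> optimal_after #|E :\ e| (move s e) f ->
    (margin (mover s) s + c <= margin (mover s) f)%R) ->
  lower E c.
Proof.
move=> eE low s f sE; rewrite (cardsD1 e) eE => -[e' [_ _ fmax]].
have [|g sg] := @optimal_after_exists _ #|E :\ e| (move s e).
  by rewrite remaining_move sE.
by apply: le_trans (low s g sE sg) (fmax e g _ sg); rewrite sE.
Qed.

Lemma lower_quiet E e c : e \in E -> points E e = 0 ->
  upper (E :\ e) (- c)%R -> lower E c.
Proof.
move=> eE e0 up; apply: (lower_move eE) => s f sE sf.
have := up _ f _ sf; rewrite remaining_move sE mover_move sE e0 eqxx.
by rewrite !margin_opponent margin_move sE e0 => /(_ erefl); lia.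
Qed.

Lemma lower_take E e c : e \in E -> 0 < points E e ->
  lower (E :\ e) c -> lower E (c + 1)%R.
Proof.
move=> eE e_gt0 low; apply: (lower_move eE) => s f sE sf.
have := low _ f _ sf; rewrite remaining_move sE mover_move sE eqn0Ngt e_gt0 /=.
by rewrite margin_move => /(_ erefl); rewrite sE; lia.
Qed.

(** Dually, every move must be answered: a scoreless one hands the turn over and flips the sign, a
    capture keeps the turn. *)
Lemma upper_moves E c : E != set0 ->
  (forall e, e \in E -> points E e = 0 /\ lower (E :\ e) (- c)%R
                     \/ points E e = 1 /\ upper (E :\ e) (c - 1)%R) ->
  upper E c.
Proof.
case/set0Pn=> e0 e0E bnd s f sE.
have -> : #|E| = #|E|.-1.+1 by rewrite (cardsD1 e0) e0E.
case=> e [eE sf _]; rewrite sE in eE.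
have En : #|E|.-1 = #|E :\ e| by rewrite (cardsD1 e) eE.
rewrite En in sf; case: (bnd e eE) => -[ek b];
  have := b _ f _ sf; rewrite remaining_move sE mover_move sE ek => /(_ erefl).
  by rewrite eqxx !margin_opponent margin_move sE ek; lia.
by rewrite /= margin_move sE ek; lia.
Qed.

Lemma lower_start_wins (adj : rel T) :
  lower (edges adj) 1 -> wins Player1 adj.
Proof.
by move=> low f /(low (start adj) f erefl); rewrite /margin /=; lia.
Qed.

Lemma upper_start_wins (adj : rel T) :
  upper (edges adj) (- 2)%R -> wins Player2 adj.
Proof.
by move=> up f /(up (start adj) f erefl); rewrite /margin /=; lia.
Qed.

End Bounds.

(** * Edges and points in graphs with two hubs *)

Section TwoHubs.

Variables (T I : finType) (hub : bool -> T) (rim : I -> T).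
Hypotheses (hub_inj : injective hub) (rim_inj : injective rim).
Hypothesis hub_rim : forall h i, hub h != rim i.

Implicit Types (S : {set bool * I}) (C : {set I}) (h g : bool) (i j k : I).

(** Booleans index the hubs so that [~~ h] is the other hub. Keeping [hub] and [rim] abstract serves
    both orders of the parts. *)
Definition spoke (p : bool * I) : {set T} := [set hub p.1; rim p.2].

Lemma hub_spoke h p : (hub h \in spoke p) = (h == p.1).
Proof. by rewrite !inE (inj_eq hub_inj) (negbTE (hub_rim _ _)) orbF. Qed.

Lemma rim_spoke i p : (rim i \in spoke p) = (i == p.2).
Proof. by rewrite !inE (inj_eq rim_inj) eq_sym (negbTE (hub_rim _ _)). Qed.

Lemma spoke_inj : injective spoke.
Proof.
move=> [h i] [g j] eq_pq.
have := hub_spoke h (h, i); rewrite eq_pq hub_spoke eqxx => /eqP /= ->.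
by have := rim_spoke i (h, i); rewrite eq_pq rim_spoke eqxx => /eqP /= ->.
Qed.

Lemma spokesD1 S p : (spoke @: S) :\ spoke p = spoke @: (S :\ p).
Proof.
apply/setP=> e; rewrite in_setD1; apply/andP/imsetP.
  case=> neq_ep /imsetP[q qS eq_eq]; exists q; rewrite // in_setD1 qS andbT.
  by apply: contraNneq neq_ep => <-; rewrite eq_eq.
by case=> q /setD1P[neq_qp qS] ->; rewrite (inj_eq spoke_inj) imset_f.
Qed.

Lemma mem_cover_spokes S x :
  reflect (exists2 p, p \in S & x \in spoke p) (x \in cover (spoke @: S)).
Proof.
rewrite cover_imset; apply: (iffP bigcupP) => [[p pS xp]|[p pS xp]];
  by exists p.
Qed.

Lemma hub_cover S h :
  reflect (exists i, (h, i) \in S) (hub h \in cover (spoke @: S)).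
Proof.
apply: (iffP (mem_cover_spokes _ _)) => [[[g i] pS]|[i hiS]].
  by rewrite hub_spoke => /eqP /= ->; exists i.
by exists (h, i); rewrite // hub_spoke.
Qed.

Lemma rim_cover S i :
  reflect (exists h, (h, i) \in S) (rim i \in cover (spoke @: S)).
Proof.
apply: (iffP (mem_cover_spokes _ _)) => [[[h j] pS]|[h hiS]].
  by rewrite rim_spoke => /eqP /= ->; exists h.
by exists (h, i); rewrite // rim_spoke.
Qed.

(** Only the two ends of the removed edge can become isolated, so counting points reduces to
    inspecting one hub and one rim vertex. *)
Lemma lost_sub_spoke S p :
  cover (spoke @: S) :\: cover (spoke @: (S :\ p)) \subset spoke p.
Proof.
apply/subsetP=> x; rewrite inE => /andP[xN /mem_cover_spokes[q qS xq]].
have [<- //|neq_qp] := eqVneq q p; case/mem_cover_spokes: xN.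
by exists q; rewrite // !inE neq_qp.
Qed.

Lemma points_quiet S h i j : (h, j) \in S -> j != i -> (~~ h, i) \in S ->
  points (spoke @: S) (spoke (h, i)) = 0.
Proof.
move=> hjS neq_ji nhiS; apply/eqP; rewrite /points spokesD1 cards_eq0.
rewrite -subset0; apply/subsetP=> x xL.
have := subsetP (lost_sub_spoke _ _) x xL; move: xL.
rewrite !inE => /andP[xN _] /orP[] /eqP /= xE; rewrite xE in xN.
  by case/hub_cover: xN; exists j; rewrite !inE xpair_eqE (negbTE neq_ji) andbF.
by case/rim_cover: xN; exists (~~ h); rewrite !inE xpair_eqE nhiS; case: (h).
Qed.

(** The rim vertex loses its last edge, while the spoke to [j] keeps the hub alive. *)
Lemma points_take S h i j :
    (h, i) \in S -> (~~ h, i) \notin S -> (h, j) \in S -> j != i ->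
  points (spoke @: S) (spoke (h, i)) = 1.
Proof.
move=> hiS nhiS hjS neq_ji; apply/eqP/cards1P; exists (rim i).
rewrite spokesD1; apply/setP=> x; rewrite in_set1.
apply/idP/eqP=> [xL|->].
  have := subsetP (lost_sub_spoke _ _) x xL; move: xL.
  rewrite !inE => /andP[xN _] /orP[] /eqP //= xE; rewrite xE in xN.
  by case/hub_cover: xN; exists j; rewrite !inE xpair_eqE (negbTE neq_ji) andbF.
rewrite inE; apply/andP; split; last by apply/rim_cover; exists h.
apply/rim_cover=> -[g]; rewrite !inE xpair_eqE eqxx andbT => /andP[neq_gh].
have -> : g = ~~ h by case: (g) (h) neq_gh => [] [].
by rewrite (negbTE nhiS).
Qed.

Lemma points_last_hub S h i :
    (h, i) \in S -> (forall j, (h, j) \in S -> j = i) ->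
  0 < points (spoke @: S) (spoke (h, i)).
Proof.
move=> hiS only_i; apply/card_gt0P; exists (hub h); rewrite spokesD1 inE.
apply/andP; split; last by apply/hub_cover; exists i.
by apply/hub_cover=> -[j]; rewrite !inE => /andP[+ /only_i jE]; rewrite jE eqxx.
Qed.

(** * Play on complete two-hub graphs *)

Definition spokes_to C : {set bool * I} := [set p | p.2 \in C].

(** An offer followed by its capture leads back to a complete graph with one rim vertex fewer, which
    is what drives the induction. *)
Lemma spokes_toD1 C h i :
  spokes_to C :\ (h, i) :\ (~~ h, i) = spokes_to (C :\ i).
Proof.
apply/setP=> -[g j]; rewrite !inE !xpair_eqE.
by case: (j == i); case: g h => [] [].
Qed.

Lemma lower_take_spoke S h i j c :
    (h, i) \in S -> (~~ h, i) \notin S -> (h, j) \in S -> j != i ->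
  lower (spoke @: (S :\ (h, i))) c -> lower (spoke @: S) (c + 1)%R.
Proof.
move=> hiS nhiS hjS neq_ji low; apply: (@lower_take _ _ (spoke (h, i))).
- exact: imset_f.
- by rewrite (points_take hiS nhiS hjS neq_ji).
- by rewrite spokesD1.
Qed.

Lemma lower_spokes1 C i : C = [set i] -> lower (spoke @: spokes_to C) 1.
Proof.
(* Both edges are captures by the same player; one point is counted for each, although the second
   isolates a hub and the rim vertex together. *)
move=> ->; apply: (@lower_le _ _ _ (0 + 1 + 1)%R) => //.
have memC h j : (h, j) \in spokes_to [set i] -> j = i.
  by rewrite inE => /set1P.
apply: (@lower_take _ _ (spoke (true, i))).
- by apply: imset_f; rewrite !inE.
- by apply: points_last_hub => [|j /memC //]; rewrite !inE.
rewrite spokesD1; apply: (@lower_take _ _ (spoke (false, i))).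
- by apply: imset_f; rewrite !inE xpair_eqE /= ?eqxx.
- by apply: points_last_hub => [|j /setD1P[_ /memC]//]; rewrite !inE xpair_eqE /= ?eqxx.
rewrite spokesD1 (@spokes_toD1 _ true).
rewrite (_ : spokes_to _ = set0) ?imset0; first exact: lower_set0.
by apply/setP=> -[h j]; rewrite !inE; case: eqP.
Qed.

Lemma upper_spokes_even C : 1 < #|C| ->
    (forall i, i \in C -> lower (spoke @: spokes_to (C :\ i)) 1) ->
  upper (spoke @: spokes_to C) (- 2)%R.
Proof.
move=> C_gt1 lowD1; apply: upper_moves.
  have /card_gt0P[i iC] : 0 < #|C| by apply: ltnW.
  by apply/set0Pn; exists (spoke (true, i)); apply: imset_f; rewrite inE.
move=> _ /imsetP[[h i] + ->]; rewrite inE /= => iC; left.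
have /card_gt0P[j] : 0 < #|C :\ i| by move: C_gt1; rewrite (cardsD1 i) iC.
rewrite !inE => /andP[neq_ji jC]; split.
  by apply: (@points_quiet _ _ _ j); rewrite ?inE.
(* One point for capturing [i], plus the bound for the odd graph without [i]. *)
rewrite spokesD1; apply: (@lower_le _ _ _ (1 + 1)%R) => //.
apply: (@lower_take_spoke _ (~~ h) i j); rewrite ?inE ?xpair_eqE ?negbK //=.
- by rewrite iC; case: (h).
- by rewrite !eqxx.
- by rewrite jC (negbTE neq_ji) andbF.
- by rewrite spokes_toD1; apply: lowD1.
Qed.

(** The vertex [k] still has both spokes and keeps both hubs alive, so each capture scores one point
    whether or not the two offers were made at the same hub. *)
Lemma lower_two_offers C h i g j k :
    i \in C -> j \in C -> k \in C -> j != i -> k != i -> k != j ->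
  lower (spoke @: spokes_to (C :\ i :\ j)) 1 ->
  lower (spoke @: (spokes_to C :\ (h, i) :\ (g, j))) 3.
Proof.
move=> iC jC kC ji ki kj low; have ij : i != j by rewrite eq_sym.
apply: (@lower_le _ _ _ (1 + 1 + 1)%R) => //.
apply: (@lower_take_spoke _ (~~ h) i k) => //; rewrite ?inE ?xpair_eqE ?negbK /=.
- by rewrite iC (negbTE ij) !andbF /=; case: (h).
- by rewrite !eqxx !andbF.
- by rewrite kC (negbTE ki) (negbTE kj) !andbF.
(* Removals commute, so the capture of [i] can be paired with its own offer. *)
have -> : spokes_to C :\ (h, i) :\ (g, j) :\ (~~ h, i)
          = spokes_to (C :\ i) :\ (g, j).
  by rewrite -(spokes_toD1 _ h) !setDDl (setUC [set (g, j)]) setUA.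
apply: (@lower_take_spoke _ (~~ g) j k) => //; rewrite ?inE ?xpair_eqE ?negbK /=.
- by rewrite jC ji andbT; case: (g).
- by rewrite !eqxx.
- by rewrite kC ki (negbTE kj) !andbF.
by rewrite spokes_toD1.
Qed.

Lemma lower_spokes_odd C : 2 < #|C| ->
    (forall i, i \in C -> upper (spoke @: spokes_to (C :\ i)) (- 2)%R) ->
    (forall i j, i \in C -> j \in C :\ i ->
       lower (spoke @: spokes_to (C :\ i :\ j)) 1) ->
  lower (spoke @: spokes_to C) 1.
Proof.
move=> C_gt2 upD1 lowD2.
have /card_gt0P[i iC] : 0 < #|C| by apply: leq_trans C_gt2.
have CD1 : 1 < #|C :\ i| by move: C_gt2; rewrite (cardsD1 i) iC.
have /card_gt0P[k] : 0 < #|C :\ i| by apply: ltnW.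
rewrite !inE => /andP[ki kC].
apply: (@lower_quiet _ _ (spoke (true, i))).
- by apply: imset_f; rewrite inE.
- by apply: (@points_quiet _ _ _ k); rewrite ?inE.
rewrite spokesD1; apply: upper_moves.
  apply/set0Pn; exists (spoke (false, i)).
  by apply: imset_f; rewrite !inE.
move=> _ /imsetP[[g j] + ->]; rewrite spokesD1 !inE xpair_eqE /=.
(* The opponent must be held to -1. Capturing [i] already scores one point, which is why the even
   case needs the bound -2 and not merely -1. *)
have [-> /andP[]|ji /andP[_ jC]] := eqVneq j i.
  case: g => // _ _; right; split; last by rewrite (@spokes_toD1 _ true); apply: upD1.
  by apply: (@points_take _ _ _ k); rewrite ?inE ?xpair_eqE ?iC ?kC ?eqxx.
(* The reply is a second offer. As [C] has at least three elements, an untouched [l] remains to keep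
   the hubs alive. *)
have /card_gt0P[l] : 0 < #|C :\ i :\ j|.
  by move: CD1; rewrite (cardsD1 j) !inE ji jC.
rewrite !inE => /and3P[lj li lC]; left; split.
  apply: (@points_quiet _ _ _ l) => //; rewrite !inE xpair_eqE /=.
    by rewrite lC (negbTE li) andbF.
  by rewrite jC (negbTE ji) andbF.
apply: (@lower_le _ _ _ 3) => //; apply: (@lower_two_offers _ _ _ _ _ l) => //.
by apply: lowD2; rewrite // !inE ji.
Qed.

(** The two parities are proved together by strong induction: even sizes call on n - 1, odd sizes on
    n - 1 and n - 2. Size 1 is separate because the odd strategy needs a third rim vertex. *)
Lemma spokes_bounds C : 0 < #|C| ->
  if odd #|C| then lower (spoke @: spokes_to C) 1
  else upper (spoke @: spokes_to C) (- 2)%R.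
Proof.
move En: #|C| => n; elim/ltn_ind: n C En => n IHn C Cn n_gt0.
have CD1 i : i \in C -> #|C :\ i| = n.-1 by rewrite -Cn (cardsD1 i C) => ->.
case: ifPn => [odd_n | even_n]; last first.
  apply: upper_spokes_even => [|i iC]; first by rewrite Cn; lia.
  have := IHn n.-1 _ _ (CD1 i iC).
  by rewrite (_ : odd _ = true); [apply; lia | lia].
have [n1 | n_neq1] := eqVneq n 1.
  by move: Cn; rewrite n1 => /eqP/cards1P[i] /lower_spokes1.
apply: lower_spokes_odd => [|i iC|i j iC jC]; first by rewrite Cn; lia.
  have := IHn n.-1 _ _ (CD1 i iC).
  by rewrite (_ : odd _ = false); [apply; lia | lia].
have CD2 : #|C :\ i :\ j| = n.-2.
  by rewrite -(CD1 i iC) (cardsD1 j (C :\ i)) jC.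
have := IHn n.-2 _ _ CD2.
by rewrite (_ : odd _ = true); [apply; lia | lia].
Qed.

Lemma two_hubs_wins (adj : rel T) :
    edges adj = spoke @: [set: bool * I] -> 0 < #|I| ->
  (odd #|I| -> wins Player1 adj) /\ (~~ odd #|I| -> wins Player2 adj).
Proof.
move=> adjE I_gt0.
have := @spokes_bounds [set: I]; rewrite cardsT => /(_ I_gt0).
have -> : spokes_to [set: I] = [set: bool * I] by apply/setP=> p; rewrite !inE.
rewrite -adjE; case: ifP => _ bnd; split=> // _.
  exact: lower_start_wins.
exact: upper_start_wins.
Qed.

End TwoHubs.

(** * The two orders of the parts of the bipartite graph *)

Definition ord_of_bool (h : bool) : 'I_2 := inord h.

Lemma ord_of_bool_inj : injective ord_of_bool.
Proof. by move=> [] [] // /(congr1 val); rewrite /ord_of_bool /= !inordK. Qed.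

Lemma ord_of_boolK (i : 'I_2) : ord_of_bool (i == 1 :> nat) = i.
Proof. by apply: val_inj; case: i => [] [|[|]] // ?; rewrite /= inordK. Qed.

Lemma edges_K2b b :
  edges (K 2 b) =
  spoke (fun h => inl (ord_of_bool h)) inr @: [set: bool * 'I_b].
Proof.
apply/setP=> e; apply/imsetP/imsetP=> [[[x y]]|[[h i] _ ->]]; last first.
  by exists (inl (ord_of_bool h), inr i); rewrite ?inE.
(* Each edge arises from both orderings of its ends; [setUC] handles the one that lists the rim
   vertex first. *)
rewrite inE; case: x y => [x|x] [y|y] // _ ->.
  by exists (x == 1 :> nat, y); rewrite // /spoke /= ord_of_boolK.
by exists (y == 1 :> nat, x); rewrite // /spoke /= ord_of_boolK setUC.
Qed.

Lemma edges_Kb2 b :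
  edges (K b 2) =
  spoke (fun h => inr (ord_of_bool h)) inl @: [set: bool * 'I_b].
Proof.
apply/setP=> e; apply/imsetP/imsetP=> [[[x y]]|[[h i] _ ->]]; last first.
  by exists (inr (ord_of_bool h), inl i); rewrite ?inE.
rewrite inE; case: x y => [x|x] [y|y] // _ ->.
  by exists (y == 1 :> nat, x); rewrite // /spoke /= ord_of_boolK setUC.
by exists (x == 1 :> nat, y); rewrite // /spoke /= ord_of_boolK.
Qed.

Theorem theorem6 (b : nat) (hb : 1 <= b) :
  (odd b -> wins Player1 (K 2 b) /\ wins Player1 (K b 2)) /\
  (~~ odd b -> wins Player2 (K 2 b) /\ wins Player2 (K b 2)).
Proof.
have [||//||odd1 even1] := two_hubs_wins _ _ _ (edges_K2b b).
- by move=> h g [] /ord_of_bool_inj.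
- by move=> i j [].
- by rewrite card_ord.
have [||//||odd2 even2] := two_hubs_wins _ _ _ (edges_Kb2 b).
- by move=> h g [] /ord_of_bool_inj.
- by move=> i j [].
- by rewrite card_ord.
rewrite card_ord in odd1 even1 odd2 even2.
by split=> parity; split; auto.
Qed.
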